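(* Let $T_1,T_2:[0,1]^2\to[0,1]$ be continuous cancellative t-norms with additive generators $t_1,t_2:[0,1]\to[0,\infty]$, respectively. If $T_1\le T_2$ (pointwise on $[0,1]^2$), then $\frac{t_1\circ t_2^{-1}(x)}{x}$ is bounded on $(0,\infty)$ if and only if $Ax\le t_1\circ t_2^{-1}(x)\le Bx$ for $x\in(0,\infty)$, where $A=\displaystyle\lim_{x\to\infty}\frac{t_1\circ t_2^{-1}(x)}{x}$ and $B=\displaystyle\lim_{x\to0^+}\frac{t_1\circ t_2^{-1}(x)}{x}$.
   Context: A t-norm is a binary operation $T:[0,1]^2\to[0,1]$ that is commutative, associative, non-decreasing in both variables and has $1$ as neutral element. It is cancellative if $T(x,y)=T(x,z)$ with $x>0$ implies $y=z$. By a known representation theorem, every continuous cancellative t-norm $T$ has an additive generator, i.e. a continuous strictly decreasing bijection $t:[0,1]\to[0,\infty]$ (so $t(0)=\infty$, $t(1)=0$) with $T(x,y)=t^{-1}(t(x)+t(y))$ for all $x,y\in[0,1]$; it is unique up to a positive multiplicative constant. *)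

(* Defs.v *)
From HB Require Import structures.
From mathcomp Require Import all_boot all_order all_algebra.
From mathcomp Require Import all_classical all_reals all_analysis.
Set Implicit Arguments.
Unset Strict Implicit.
Unset Printing Implicit Defensive.
Import Order.TTheory GRing.Theory Num.Theory.
Import numFieldNormedType.Exports.
Local Open Scope classical_set_scope.
Local Open Scope ring_scope.

(* A binary operation on [0, 1] is a total map T : R -> R -> R of which only
   the values on [0, 1]^2 matter; likewise a map [0, 1] -> [0, +oo] is a map
   R -> \bar R of which only the values on [0, 1] matter. *)

Record is_tnorm (R : realType) (T : R -> R -> R) : Prop := IsTnorm {
  tnorm_range : forall x y, x \in `[0, 1] -> y \in `[0, 1] ->
    T x y \in `[0, 1];
  tnormC : forall x y, x \in `[0, 1] -> y \in `[0, 1] -> T x y = T y x;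
  tnormA : forall x y z, x \in `[0, 1] -> y \in `[0, 1] -> z \in `[0, 1] ->
    T x (T y z) = T (T x y) z;
  tnorm_le : forall x x' y y', x \in `[0, 1] -> x' \in `[0, 1] ->
    y \in `[0, 1] -> y' \in `[0, 1] -> x <= x' -> y <= y' -> T x y <= T x' y';
  tnormx1 : forall x, x \in `[0, 1] -> T x 1 = x
}.

Definition tnorm_continuous (R : realType) (T : R -> R -> R) : Prop :=
  {within `[0, 1] `*` `[0, 1], continuous (fun p : R * R => T p.1 p.2)}.

Definition tnorm_cancellative (R : realType) (T : R -> R -> R) : Prop :=
  forall x y z, x \in `[0, 1] -> y \in `[0, 1] -> z \in `[0, 1] ->
    0 < x -> T x y = T x z -> y = z.

(* The inverse [0, +oo] -> [0, 1] of t. *)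
Definition gen_inv (R : realType) (t : R -> \bar R) : \bar R -> R :=
  'pinv_(fun=> 0) `[0, 1] t.

Record additive_generator (R : realType) (t : R -> \bar R)
    (T : R -> R -> R) : Prop := AdditiveGenerator {
  gen_continuous : {within `[0, 1], continuous t};
  gen_decreasing : forall x y, x \in `[0, 1] -> y \in `[0, 1] ->
    x < y -> (t y < t x)%E;
  gen_bij : set_bij `[0, 1] [set u | (0 <= u)%E] t;
  gen0 : t 0 = +oo%E;
  gen1 : t 1 = 0%E;
  genE : forall x y, x \in `[0, 1] -> y \in `[0, 1] ->
    T x y = gen_inv t (t x + t y)%E
}.

(* Main.v *)
(* The map h := t1 o t2^-1 is nondecreasing, and T1 <= T2 says exactly that h is
   subadditive. Bounding h x by (floor (x / y) + 1) h y gives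
   h x / (x + y) <= h y / y for all x, y > 0. Letting the larger variable tend to
   infinity, or the smaller one to 0, identifies A with the infimum and B with
   the supremum of h x / x over x > 0. *)
Require Import Defs.
From HB Require Import structures.
From mathcomp Require Import all_boot all_order all_algebra.
From mathcomp Require Import all_classical all_reals all_analysis.
From mathcomp Require Import ring lra.
Set Implicit Arguments.
Unset Strict Implicit.
Unset Printing Implicit Defensive.
Import Order.TTheory GRing.Theory Num.Theory.
Import numFieldNormedType.Exports.
Local Open Scope classical_set_scope.
Local Open Scope ring_scope.

(** Treats a limit that is a supremum and may be infinite: for finite [B] the two bounds squeeze
    [f], and for [B = +oo] the last hypothesis is divergence itself. *)
Lemma cvg_to_upper_bound (R : realType) (T : Type) (F : set_system T)
    (FF : Filter F) (f : T -> R) (B : \bar R) :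
  (\forall x \near F, ((f x)%:E <= B)%E) -> B != -oo%E ->
  (forall b : R, (b%:E < B)%E -> \forall x \near F, b < f x) ->
  (f x)%:E @[x --> F] --> B.
Proof.
case: B => [B| |] // leB _ ltB.
- apply: cvg_EFin; first exact: nearW.
  apply/cvgrPdist_lt => e e0.
  have Be : ((B - e)%:E < B%:E)%E by rewrite lte_fin; lra.
  have := ltB _ Be; apply: filterS2 leB => x /=.
  by rewrite lee_fin => xB Bx; rewrite ger0_norm; lra.
- apply/cvgeyPgt => b.
  have := ltB b (ltry b); apply: filterS => x /=.
  by rewrite lte_fin.
Qed.

Section SubadditiveFunction.
Variables (R : realType) (g : R -> R).
Hypothesis g_ge0 : forall x : R, 0 < x -> 0 <= g x.
Hypothesis g_nondecreasing : forall x y : R, 0 < x -> x <= y -> g x <= g y.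
Hypothesis g_subadditive :
  forall x y : R, 0 < x -> 0 < y -> g (x + y) <= g x + g y.

(** The factor is [n.+1] because subadditivity is only assumed at positive arguments. *)
Lemma subadditive_muln (n : nat) (x : R) :
  0 < x -> g (n.+1%:R * x) <= n.+1%:R * g x.
Proof.
move=> x0; elim: n => [|n IHn]; first by rewrite !mul1r.
have -> : n.+2%:R * x = n.+1%:R * x + x by rewrite -natr1; ring.
have -> : n.+2%:R * g x = n.+1%:R * g x + g x by rewrite -[n.+2%:R]natr1; ring.
have nx0 : 0 < n.+1%:R * x by rewrite mulr_gt0.
by apply: le_trans (g_subadditive nx0 x0) _; rewrite lerD2r.
Qed.

(** The denominator [x + y] absorbs the rounding of [x / y]: with [n] its integer part,
    [x <= n.+1 * y <= x + y]. The excess over [x] is negligible both for large [x] and for small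
    [y]. *)
Lemma subadditive_ratio_le (x y : R) :
  0 < x -> 0 < y -> g x / (x + y) <= g y / y.
Proof.
move=> x0 y0.
rewrite ler_pdivrMr ?addr_gt0// mulrAC ler_pdivlMr//.
have /truncn_itv/andP[nle ltn] : 0 <= x / y by rewrite divr_ge0// ltW.
set n := Num.truncn _ in nle ltn.
have nxy : n%:R * y <= x by rewrite -ler_pdivlMr.
have xny : x <= n.+1%:R * y by rewrite -ler_pdivrMr// ltW.
apply: (@le_trans _ _ (n.+1%:R * g y * y)).
  rewrite ler_pM2r//; apply: le_trans (subadditive_muln n y0).
  exact: g_nondecreasing.
rewrite mulrAC mulrC ler_wpM2l ?g_ge0//.
by rewrite -natr1; lra.
Qed.

Let ratios : set R := [set g x / x | x in [set x | 0 < x]].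

Lemma subadditive_ratio_ge0 (x : R) : 0 < x -> 0 <= g x / x.
Proof. by move=> x0; rewrite divr_ge0 ?g_ge0// ltW. Qed.

Lemma subadditive_has_inf_ratio : has_inf ratios.
Proof.
split; first by exists (g 1 / 1), 1 => //=.
by exists 0 => _ [x x0 <-]; exact: subadditive_ratio_ge0.
Qed.

Lemma subadditive_inf_ratio_le (x : R) : 0 < x -> inf ratios <= g x / x.
Proof.
by move=> x0; apply: ge_inf; [case: subadditive_has_inf_ratio|exists x].
Qed.

(** A continuous-variable form of Fekete's lemma: a fixed [y] whose ratio nearly attains the infimum
    controls all large [x], since [g x / x <= g y / y + g y / x]. *)
Lemma subadditive_cvg_pinfty : g x / x @[x --> +oo] --> inf ratios.
Proof.
apply/cvgrPdist_lt => e e0.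
have [_ [y /= y0 <-] ye] := inf_adherent e0 subadditive_has_inf_ratio.
set L := inf ratios in ye *.
(* The room left for the error term: [g y / x < d] as soon as [x] is large. *)
set d := L + e - g y / y.
have d0 : 0 < d by rewrite /d subr_gt0.
near=> x.
have x0 : 0 < x by near: x; apply: nbhs_pinfty_gt; exact: num_real.
have Lx : L <= g x / x := subadditive_inf_ratio_le x0.
have gyd : g y < x * d.
  by rewrite -ltr_pdivrMr//; near: x; apply: nbhs_pinfty_gt; exact: num_real.
have := subadditive_ratio_le x0 y0.
rewrite ler_pdivrMr ?addr_gt0// => gx.
suff : g x / x < L + e by move=> ?; rewrite distrC ger0_norm; lra.
rewrite ltr_pdivrMr//; apply: le_lt_trans gx _.
rewrite mulrDr divfK ?gt_eqF//.
by rewrite /d in gyd; lra.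
Unshelve. all: by end_near. Qed.

(** Here the large variable [y] is fixed with ratio above [b]; the lower bound [g y / (x + y)] for
    [g x / x] tends to [g y / y] as [x] tends to 0. The supremum is extended because ratios may blow
    up at 0. *)
Lemma subadditive_cvg_0 : (g x / x)%:E @[x --> 0^'+] -->
  ereal_sup [set (g x / x)%:E | x in [set x | 0 < x]].
Proof.
apply: cvg_to_upper_bound.
- near=> x; apply: ereal_sup_ubound; exists x => //=.
- rewrite -ltNye; apply: (@lt_le_trans _ _ (g 1 / 1)%:E); first exact: ltNyr.
  by apply: ereal_sup_ubound; exists 1 => //=.
- move=> b /ereal_sup_gt[_ [y /= y0 <-]]; rewrite lte_fin => b_lt.
  have c0 : 0 < g y - b * y by rewrite subr_gt0 -ltr_pdivlMr.
  (* The goal will reduce to [b * x < g y - b * y]. Dividing by [|b| + 1] instead of [b] gives a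
     valid threshold for [x] whatever the sign of [b]. *)
  have b1 : 0 < `|b| + 1 by rewrite ltr_wpDl.
  near=> x.
  have x0 : 0 < x by [].
  have := subadditive_ratio_le y0 x0; apply: lt_le_trans.
  rewrite ltr_pdivlMr ?addr_gt0//.
  have xc : x < (g y - b * y) / (`|b| + 1).
    by near: x; apply: nbhs_right_lt; rewrite divr_gt0.
  move: xc; rewrite ltr_pdivlMr// => xc.
  have : b * x <= `|b| * x by rewrite ler_pM2r// ler_norm.
  lra.
Unshelve. all: by end_near. Qed.

End SubadditiveFunction.

Section Generator.
Variables (R : realType) (t : R -> \bar R) (T : R -> R -> R).
Hypothesis t_gen : additive_generator t T.

Lemma gen_invK (u : \bar R) : (0 <= u)%E -> t (gen_inv t u) = u.
Proof.
move=> u0; have [_ _ tsurj] := gen_bij t_gen.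
by apply: pinvK; rewrite inE; exact: tsurj.
Qed.

Lemma gen_inv_itv (u : \bar R) : (0 <= u)%E -> gen_inv t u \in `[0, 1].
Proof.
move=> u0; have [tfun _ _] := bijpinv_bij (fun=> 0) (gen_bij t_gen).
exact: tfun.
Qed.

Lemma gen_ge0 (x : R) : x \in `[0, 1] -> (0 <= t x)%E.
Proof. by move=> xI; have [tfun _ _] := gen_bij t_gen; exact: tfun. Qed.

Lemma gen_nonincreasing (x y : R) :
  x \in `[0, 1] -> y \in `[0, 1] -> x <= y -> (t y <= t x)%E.
Proof.
move=> xI yI; rewrite le_eqVlt => /predU1P[->//|xy].
by rewrite ltW// (gen_decreasing t_gen).
Qed.

Lemma gen_inv_nonincreasing (u v : \bar R) :
  (0 <= u)%E -> (u <= v)%E -> gen_inv t v <= gen_inv t u.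
Proof.
move=> u0 uv; have v0 := le_trans u0 uv; rewrite leNgt; apply/negP => vu.
have := gen_decreasing t_gen (gen_inv_itv u0) (gen_inv_itv v0) vu.
by rewrite !gen_invK// ltNge uv.
Qed.

Lemma gen_fin_num (x : R) : x \in `[0, 1] -> 0 < x -> t x \is a fin_num.
Proof.
move=> xI x0; rewrite ge0_fin_numE ?gen_ge0// -(gen0 t_gen).
by apply: (gen_decreasing t_gen) => //; rewrite in_itv /= lexx ler01.
Qed.

(** A preimage equal to 0 would force the finite [u] to be [t 0 = +oo]. With [gen_fin_num], this
    makes [t1 \o gen_inv t2] finite at finite nonnegative arguments. *)
Lemma gen_inv_gt0 (u : R) : 0 <= u -> 0 < gen_inv t u%:E.
Proof.
move=> u0; have uI := @gen_inv_itv u%:E u0.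
rewrite lt_neqAle (itvP uI) andbT; apply/eqP => i0.
by have := @gen_invK u%:E u0; rewrite -i0 (gen0 t_gen).
Qed.

End Generator.

(** Evaluate [T1 <= T2] at the preimages of [u] and [v] under [t2], then apply the decreasing [t1]:
    the [T2] side becomes the value at [u + v], the [T1] side the sum of values. *)
Lemma gen_comp_subadditive (R : realType) (T1 T2 : R -> R -> R)
    (t1 t2 : R -> \bar R) (u v : \bar R) :
  is_tnorm T1 -> is_tnorm T2 ->
  additive_generator t1 T1 -> additive_generator t2 T2 ->
  (forall x y : R, x \in `[0, 1] -> y \in `[0, 1] -> T1 x y <= T2 x y) ->
  (0 <= u)%E -> (0 <= v)%E ->
  (t1 (gen_inv t2 (u + v)) <= t1 (gen_inv t2 u) + t1 (gen_inv t2 v))%E.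
Proof.
move=> T1n T2n t1g t2g T12 u0 v0.
have uI := gen_inv_itv t2g u0; have vI := gen_inv_itv t2g v0.
have := T12 _ _ uI vI.
move/(gen_nonincreasing t1g (tnorm_range T1n uI vI) (tnorm_range T2n uI vI)).
rewrite (genE t1g)// (genE t2g)// !(gen_invK t2g)// (gen_invK t1g)//.
by rewrite adde_ge0// (gen_ge0 t1g).
Qed.

(** Finiteness of [A] and [B] belongs to the right-hand side of the equivalence: with [B = +oo] the
    upper bound would hold trivially while the ratio is unbounded. *)
Theorem proposition4p2 (R : realType) (T1 T2 : R -> R -> R)
    (t1 t2 : R -> \bar R)
    (T1_tnorm : is_tnorm T1) (T2_tnorm : is_tnorm T2)
    (T1_cont : tnorm_continuous T1) (T2_cont : tnorm_continuous T2)
    (T1_canc : tnorm_cancellative T1) (T2_canc : tnorm_cancellative T2)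
    (t1_gen : additive_generator t1 T1) (t2_gen : additive_generator t2 T2)
    (T1_le_T2 : forall x y : R, x \in `[0, 1] -> y \in `[0, 1] ->
      T1 x y <= T2 x y) :
  let h : \bar R -> \bar R := t1 \o gen_inv t2 in
  exists A B : \bar R,
    [/\ (h x%:E / x%:E)%E @[x --> +oo] --> A,
        (h x%:E / x%:E)%E @[x --> 0^'+] --> B &
        (exists M : R, forall x : R, 0 < x -> (`| h x%:E / x%:E | <= M%:E)%E)
        <->
        [/\ A \is a fin_num, B \is a fin_num &
            forall x : R, 0 < x ->
              (A * x%:E <= h x%:E)%E /\ (h x%:E <= B * x%:E)%E]].
Proof.
(* [fine] sends infinite values to 0, but [hE] shows that [h] is finite at positive reals, so [g]
   agrees with [h] there. *)
move=> h; pose g x := fine (h x%:E).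
have hE x : 0 < x -> h x%:E = (g x)%:E.
  move=> x0; rewrite fineK// (gen_fin_num t1_gen)//.
    by apply: (gen_inv_itv t2_gen); rewrite lee_fin ltW.
  by apply: (gen_inv_gt0 t2_gen); rewrite ltW.
have ratioE x : 0 < x -> (h x%:E / x%:E)%E = (g x / x)%:E.
  by move=> x0; rewrite hE// inver gt_eqF.
have g_ge0 x : 0 < x -> 0 <= g x.
  move=> x0; rewrite fine_ge0// (gen_ge0 t1_gen)//.
  by apply: (gen_inv_itv t2_gen); rewrite lee_fin ltW.
have g_nd x y : 0 < x -> x <= y -> g x <= g y.
  move=> x0 xy; have y0 := lt_le_trans x0 xy.
  rewrite -lee_fin -!hE//; have [/ltW x0' /ltW y0'] := (x0, y0).
  apply: (gen_nonincreasing t1_gen); rewrite ?(gen_inv_itv t2_gen)//.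
  exact: (gen_inv_nonincreasing t2_gen).
have g_sub x y : 0 < x -> 0 < y -> g (x + y) <= g x + g y.
  move=> x0 y0; rewrite -lee_fin EFinD -!hE ?addr_gt0// EFinD.
  apply: (gen_comp_subadditive T1_tnorm T2_tnorm) => //.
    by rewrite lee_fin ltW.
  by rewrite lee_fin ltW.
(* Ratios are bounded below by 0, so a real infimum suffices for [A], whereas [B] may be [+oo]. *)
pose A := inf [set g x / x | x in [set x | 0 < x]].
pose B := ereal_sup [set (g x / x)%:E | x in [set x | 0 < x]].
have ratio_le_B x : 0 < x -> ((g x / x)%:E <= B)%E.
  by move=> x0; apply: ereal_sup_ubound; exists x.
exists A%:E, B; split.
- have : (g x / x)%:E @[x --> +oo] --> A%:E.
    apply: cvg_EFin; first exact: nearW.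
    exact: subadditive_cvg_pinfty.
  apply: cvg_trans; apply: near_eq_cvg.
  by near=> x; rewrite ratioE.
- have := subadditive_cvg_0 g_ge0 g_nd g_sub.
  apply: cvg_trans; apply: near_eq_cvg.
  by near=> x; rewrite ratioE.
- split=> [[M hM]|[_ Bfin hAB]].
  (* A uniform bound on the ratios bounds their supremum, hence [B] is finite; the two inequalities
     are then those of an infimum and a supremum. *)
  + have B_le : (B <= M%:E)%E.
      apply: ge_ereal_sup => _ [x /= x0 <-]; rewrite -ratioE//.
      exact: le_trans (lee_abs _) (hM _ x0).
    have B_ge0 : (0 <= B)%E.
      apply: le_trans (ratio_le_B 1 ltr01).
      by rewrite lee_fin divr1 g_ge0.
    have Bfin : B \is a fin_num.
      by rewrite ge0_fin_numE// (le_lt_trans B_le)// ltry.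
    split=> // x x0; rewrite hE//; split.
      rewrite -EFinM lee_fin -ler_pdivlMr//.
      exact: subadditive_inf_ratio_le.
    have := ratio_le_B _ x0.
    by rewrite -(fineK Bfin) -EFinM !lee_fin ler_pdivrMr.
  (* Ratios are nonnegative, so their supremum, now a real number, also bounds their absolute
     values. *)
  + exists (fine B) => x x0; rewrite fineK// ratioE// gee0_abs ?ratio_le_B//.
    by rewrite lee_fin divr_ge0 ?g_ge0// ltW.
Unshelve. all: by end_near. Qed.
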